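(* Let $n \in \mathbb{N}$ and $t \in \mathbb{N}_0$. Then there exists a finite set $X \subseteq UT_n(\mathbb{R}_{\max})$ such that $t$ is the rank of the free abelian subgroup of $(\mathbb{R},+)$ generated as a group by the finite entries of the matrices in $\langle X\rangle$, and the growth function of $\langle X \rangle$ is bounded below by $ck^{\frac{tn(n+1)}{2}}$ for some $c > 0$.
   Context: $\mathbb{N}$ is the set of positive integers and $\mathbb{N}_0$ the set of non-negative integers. $\mathbb{R}_{\max}=\mathbb{R}\cup\{-\infty\}$ is the tropical semiring, with semiring addition $\max$ and semiring multiplication the usual addition (zero $-\infty$, one $0$). $UT_n(\mathbb{R}_{\max})$ is the monoid, under (tropical) matrix multiplication, of all $n\times n$ matrices over $\mathbb{R}_{\max}$ with all entries below the diagonal equal to $-\infty$. A finite entry is an entry different from $-\infty$. $\langle X\rangle$ is the subsemigroup generated by $X$. For a semigroup generated by a finite set $X$, its growth function (with respect to $X$) is $f_X(k) = |\bigcup_{i=1}^k X^i|$ for $k\in\mathbb{N}$, where $X^i$ is the set of products of $i$ elements of $X$. It is bounded below by $ck^m$ if $f_X(k)\ge ck^m$ for all $k\in\mathbb{N}$. *)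

(* Defs.v *)
From HB Require Import structures.
From mathcomp Require Import all_boot all_order all_algebra.
From mathcomp Require Import finmap.
From mathcomp Require Import boolp classical_sets reals.

Set Implicit Arguments.
Unset Strict Implicit.
Unset Printing Implicit Defensive.

Import Order.TTheory GRing.Theory Num.Theory.

Local Open Scope ring_scope.

(* The tropical (max-plus) semiring over R. [None] is the element -oo and
   [Some x] is the finite element x, so in the semiring structure below
   0 is -oo, 1 is [Some 0], + is max and * is the addition of R. *)
Definition tropical (R : realDomainType) : Type := option R.

HB.instance Definition _ (R : realDomainType) := Choice.on (tropical R).

Section Tropical.
Variable R : realDomainType.
Implicit Types x y z : tropical R.

Definition tropical_add x y : tropical R :=
  match x, y with
  | Some a, Some b => Some (Num.max a b)
  | None, _ => y
  | _, None => x
  end.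

Definition tropical_mul x y : tropical R :=
  match x, y with
  | Some a, Some b => Some (a + b)
  | _, _ => None
  end.

Lemma tropical_addA : associative tropical_add.
Proof. by move=> [a|] [b|] [c|] //=; rewrite maxA. Qed.

Lemma tropical_addC : commutative tropical_add.
Proof. by move=> [a|] [b|] //=; rewrite maxC. Qed.

Lemma tropical_add0 : left_id (None : tropical R) tropical_add.
Proof. by case. Qed.

HB.instance Definition _ := GRing.isNmodule.Build (tropical R)
  tropical_addA tropical_addC tropical_add0.

Lemma tropical_mulA : associative tropical_mul.
Proof. by move=> [a|] [b|] [c|] //=; rewrite addrA. Qed.

Lemma tropical_mulC : commutative tropical_mul.
Proof. by move=> [a|] [b|] //=; rewrite addrC. Qed.

Lemma tropical_mul1 : left_id (Some 0 : tropical R) tropical_mul.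
Proof. by move=> [a|] //=; rewrite add0r. Qed.

Lemma tropical_mulDl : left_distributive tropical_mul +%R.
Proof. by move=> [a|] [b|] [c|] //; congr Some; rewrite addr_maxl. Qed.

Lemma tropical_mul0 : left_zero 0 tropical_mul.
Proof. by []. Qed.

Lemma tropical_one_neq0 : (Some 0 : tropical R) != 0.
Proof. by []. Qed.

HB.instance Definition _ := GRing.Nmodule_isComNzSemiRing.Build (tropical R)
  tropical_mulA tropical_mulC tropical_mul1 tropical_mulDl tropical_mul0
  tropical_one_neq0.

End Tropical.

Definition UT (R : realDomainType) (n : nat) : set 'M[tropical R]_n :=
  fun A => forall i j : 'I_n, (j < i)%N -> A i j = 0.

Definition finite_entries (R : realDomainType) (n : nat)
    (S : set 'M[tropical R]_n) : set R :=
  fun x => exists A, S A /\ exists i j : 'I_n, A i j = Some x.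

Section Semigroup.
Variables (T : choiceType) (op : T -> T -> T).

Definition subsemigroup_closed (S : set T) : Prop :=
  forall a b, S a -> S b -> S (op a b).

Definition subsemigroup_gen (X : set T) : set T :=
  smallest subsemigroup_closed X.

(* Since a semigroup has no empty product, the index is shifted:
   [products X i] is the set of products of i + 1 elements of X. *)
Fixpoint products (X : {fset T}) (i : nat) : {fset T} :=
  if i is j.+1 then [fset op a b | a in X, b in products X j]%fset else X.

Definition growth (X : {fset T}) (k : nat) : nat :=
  #|` \big[fsetU/fset0]_(i < k) products X i|%fset.

End Semigroup.

Definition poly_bounded_below (R : numDomainType) (f : nat -> nat) (c : R)
    (m : nat) : Prop :=
  forall k : nat, (0 < k)%N -> c * k%:R ^+ m <= (f k)%:R.

Definition subgroup_gen (V : zmodType) (X : set V) : set V :=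
  smallest (fun H => zmod_closed (mem H)) X.

Definition free_abelian_of_rank (V : zmodType) (H : set V) (t : nat) : Prop :=
  exists b : 'I_t -> V,
    (forall x, H x <-> exists z : 'I_t -> int, x = \sum_i b i *~ z i) /\
    (forall z : 'I_t -> int, \sum_i b i *~ z i = 0 -> forall i, z i = 0).

(* Main.v *)
Require Import Defs.
From mathcomp Require Import all_boot all_order all_algebra.
From mathcomp Require Import finmap.
From mathcomp Require Import boolp classical_sets reals exp.

(** The idea is that a matrix of UT_n with all its upper entries finite has
n(n+1)/2 free entries, that each entry may be chosen in a group Z^t, and that a
matrix whose entries have coordinates at most m can be written as a product of
O(m) generators. The products of length at most k then include at least
(k / C)^(t n(n+1)/2) different matrices.

Let b_1, ..., b_t be logarithms of distinct primes; by unique factorization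
they are linearly independent over Z ([ln_primes_free]). The generators are the
identity, the diagonal matrices with b_s or - b_s in one diagonal position and
the real number 0 in the others, and, in semiring notation, the matrices
1 + e_ij with i < j. Products of these have
entries in the Z-span of the b_s, and the b_s themselves occur, so the group of
entries is free of rank t ([subgroup_gen_entries]).

Tropical addition is idempotent, so powers of 1 + e_ij are useless for moving
its off-diagonal entry. Conjugation by a diagonal matrix D does the work
instead: D (1 + e_ij) D^-1 = 1 + x e_ij when D has x at position i and the
real number 0 at the others ([transvection_conj]). Therefore 1 + x e_ij is a
word of length linear in the coordinates of x. Although the semiring has no
subtraction, a strictly upper triangular matrix U with entries x_ij still
satisfies 1 + U = prod (1 + x_ij e_ij), provided that the factors are ordered
by decreasing i: then no product e_ij e_kl of an earlier factor by a later one
has j = k, and the expansion leaves only the linear terms ([prod_1D],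
[strict_upper_prod]). Multiplying on the left by a diagonal matrix gives
matrices which determine all their parameters ([encode_inj]) and which are
short words ([encode_word]). *)

Set Implicit Arguments.
Unset Strict Implicit.
Unset Printing Implicit Defensive.

Import Order.TTheory GRing.Theory Num.Theory.

Local Open Scope classical_set_scope.
Local Open Scope ring_scope.

(** * Reals that are linearly independent over the integers *)

Lemma increasing_primes_exist :
  exists p : nat -> nat,
    (forall s, prime (p s)) /\ {homo p : r s / (r < s)%N >-> (r < s)%N}.
Proof.
pose next m := pdiv (m`!.+1)%N.
have next_prime m : prime (next m) by rewrite pdiv_prime // ltnS fact_gt0.
have next_gt m : (m < next m)%N.
  rewrite ltnNge; apply/negP => le_next.
  (* Otherwise next m divides both m! and m! + 1. *)
  have : (next m %| m`!.+1)%N by exact: pdiv_dvd.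
  rewrite -addn1 dvdn_addr; last first.
    by apply: dvdn_fact; rewrite prime_gt0 ?next_prime.
  by rewrite dvdn1 => /eqP next1; have := next_prime m; rewrite next1.
exists (fun s => iter s.+1 next 0%N); split=> [s|]; first by rewrite iterS.
by apply: homo_ltn => [|s]; [exact: ltn_trans|]; rewrite [X in (_ < X)%N]iterS.
Qed.

Lemma logn_prod (p : nat) (I : Type) (r : seq I) (F : I -> nat) :
  (forall i, (0 < F i)%N) ->
  logn p (\prod_(i <- r) F i) = (\sum_(i <- r) logn p (F i))%N.
Proof.
move=> F_gt0; elim: r => [|i r IHr]; first by rewrite !big_nil logn1.
by rewrite !big_cons lognM ?F_gt0 ?IHr // prodn_gt0.
Qed.

Lemma logn_prod_primes (t : nat) (p : 'I_t -> nat) (a : 'I_t -> nat) :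
  (forall s, prime (p s)) -> injective p ->
  forall s, logn (p s) (\prod_r p r ^ a r) = a s.
Proof.
move=> p_prime p_inj s; rewrite logn_prod => [|r]; last first.
  by rewrite expn_gt0 prime_gt0.
rewrite (bigD1 s) //= lognX logn_prime // eqxx muln1 big1 ?addn0 // => r r_s.
by rewrite lognX logn_prime // (inj_eq p_inj) eq_sym (negPf r_s) muln0.
Qed.

Lemma expR_sum_ln (R : realType) (t : nat) (p a : 'I_t -> nat) :
  (forall s, 0 < p s)%N ->
  sequences.expR (\sum_s ln ((p s)%:R : R) *+ a s) = (\prod_s p s ^ a s)%:R.
Proof.
move=> p_gt0; rewrite expR_sum natr_prod; apply: eq_bigr => s _.
by rewrite -[ln _ *+ _]mulr_natl expRM_natl lnK ?posrE ?ltr0n // natrX.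
Qed.

(** Separating positive and negative coefficients and exponentiating turns a
linear relation into an equality between two products of prime powers, where
the valuation at each prime compares the exponents. *)
Lemma ln_primes_free (R : realType) (t : nat) (p : 'I_t -> nat) :
  (forall s, prime (p s)) -> injective p ->
  forall z : 'I_t -> int,
    \sum_s ln ((p s)%:R : R) *~ z s = 0 -> forall s, z s = 0.
Proof.
move=> p_prime p_inj z z0 s; have p_gt0 r : (0 < p r)%N by exact: prime_gt0.
pose pos r := if (0 <= z r) then `|z r|%N else 0%N.
pose neg r := if (0 <= z r) then 0%N else `|z r|%N.
have zE r : z r = (pos r)%:Z - (neg r)%:Z.
  rewrite /pos /neg; case: ifPn => [z_ge0|]; first by rewrite subr0 gez0_abs.
  by rewrite -ltNge => z_lt0; rewrite sub0r ltz0_abs // opprK.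
have : \sum_s ln ((p s)%:R : R) *+ pos s = \sum_s ln ((p s)%:R : R) *+ neg s.
  apply/eqP; rewrite -subr_eq0 -sumrB -[X in _ == X]z0; apply/eqP.
  by apply: eq_bigr => r _; rewrite zE mulrzBr.
move/(congr1 sequences.expR); rewrite !expR_sum_ln // => /eqP.
rewrite eqr_nat => /eqP /(congr1 (logn (p s))).
by rewrite !logn_prod_primes // zE => ->; rewrite subrr.
Qed.

(** * Word length and growth *)

Section WordLength.
Variables (S : pzSemiRingType) (X : {fset S}).

(** The empty word is allowed, so that products of any number of words, even of
none, have an additive bound. [growth] does not count it, but when 1 is a
generator the empty word has the same value as a word with one letter. *)
Definition word_of_length_le (l : nat) (a : S) : Prop :=
  exists2 w : seq S, {subset w <= X} /\ (size w <= l)%N & a = \prod_(x <- w) x.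

Lemma word_gen a : a \in X -> word_of_length_le 1 a.
Proof.
move=> aX; exists [:: a]; last by rewrite big_seq1.
by split=> // x; rewrite inE => /eqP ->.
Qed.

Lemma word_mul l m a b :
  word_of_length_le l a -> word_of_length_le m b ->
  word_of_length_le (l + m) (a * b).
Proof.
move=> [v [vX v_l] ->] [w [wX w_m] ->].
exists (v ++ w); last by rewrite big_cat.
by split=> [x|]; [rewrite mem_cat => /orP[/vX|/wX] | rewrite size_cat leq_add].
Qed.

Lemma word_le l m a :
  (l <= m)%N -> word_of_length_le l a -> word_of_length_le m a.
Proof.
by move=> lm [w [wX w_l] ->]; exists w; split=> //; apply: leq_trans lm.
Qed.

Lemma word_prod (I : eqType) (r : seq I) (F : I -> S) l :
  {in r, forall i, word_of_length_le l (F i)} ->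
  word_of_length_le (size r * l) (\prod_(i <- r) F i).
Proof.
elim: r => [|i r IHr] F_l; first by exists [::]; rewrite ?big_nil.
rewrite big_cons mulSn; apply: word_mul; first by apply: F_l; rewrite mem_head.
by apply: IHr => j jr; apply: F_l; rewrite in_cons jr orbT.
Qed.

Lemma word_prod_ord k (F : 'I_k -> S) l :
  (forall i, word_of_length_le l (F i)) ->
  word_of_length_le (k * l) (\prod_i F i).
Proof.
move=> F_l; rewrite -[k in (k * l)%N]size_enum_ord enumT.
by apply: word_prod => i _; exact: F_l.
Qed.

Lemma word_expr a l : a \in X -> word_of_length_le l (a ^+ l).
Proof.
move=> aX; exists (nseq l a); last by rewrite big_nseq iter_mulr_1.
by split=> [x|]; [rewrite mem_nseq => /andP[_ /eqP ->] | rewrite size_nseq].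
Qed.

Lemma word_products i w :
  {subset w <= X} -> size w = i.+1 -> \prod_(x <- w) x \in products *%R X i.
Proof.
elim: i w => [|i IHi] [|a w] //= wX [sz_w].
  by rewrite (size0nil sz_w) big_seq1; apply: wX; rewrite mem_head.
rewrite big_cons; apply/imfset2P; exists a.
  by apply: wX; rewrite mem_head.
exists (\prod_(x <- w) x) => //; apply: IHi => // x xw.
by apply: wX; rewrite in_cons xw orbT.
Qed.

(** The basic counting principle: an injective family of short words. *)
Lemma growth_ge (I : finType) (P : {pred I}) (F : I -> S) k :
  1 \in X -> (0 < k)%N -> {in P &, injective F} ->
  {in P, forall i, word_of_length_le k (F i)} -> (#|P| <= growth *%R X k)%N.
Proof.
move=> X1 k_gt0 F_inj F_k.
have <- : #|` [fset F i | i in P]%fset| = #|P|.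
  by rewrite card_in_imfset // -cardE.
apply: fsubset_leq_card; apply/fsubsetP => _ /imfsetP[i /= iP ->].
have [w [wX w_k] ->] := F_k i iP.
have [j [jk wj]] : exists j, (j < k)%N /\ \prod_(x <- w) x \in products *%R X j.
  (* The index of [products] is one less than the length of the word; the empty
     word is replaced by the one-letter word 1. *)
  case: (w) wX w_k => [|a v] wX w_k; first by exists 0%N; rewrite big_nil.
  by exists (size v); split=> //; apply: word_products.
by apply/bigfcupP; exists (Ordinal jk); rewrite // mem_index_enum.
Qed.

Lemma growth_gt0 k : 1 \in X -> (0 < k)%N -> (0 < growth *%R X k)%N.
Proof.
move=> X1 k_gt0; rewrite -[X in (X <= _)%N]card_unit.
apply: (growth_ge (F := fun=> 1)) => //; first by move=> [] [].
by move=> u _; exact: word_le k_gt0 (word_gen X1).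
Qed.
End WordLength.

(** Only products of an earlier term by a later one appear in the expansion, so
the linear terms are all that is left when these vanish. *)
Lemma prod_1D (S : pzSemiRingType) (I : eqType) (u : I -> S) (r : seq I) :
  pairwise (fun i j => u i * u j == 0) r ->
  \prod_(i <- r) (1 + u i) = 1 + \sum_(i <- r) u i.
Proof.
elim: r => [|i r IHr] /=; first by rewrite !big_nil addr0.
case/andP => /allP/= ui0 /IHr r_prod; rewrite !big_cons r_prod mulrDl mul1r.
have u_sum0 : u i * \sum_(j <- r) u j = 0.
  rewrite mulr_sumr big1_seq // => j /andP[_ jr]; apply/eqP; exact: ui0.
by rewrite mulrDr mulr1 u_sum0 addr0 addrAC -addrA.
Qed.

(** * Tropical diagonal matrices and transvections *)

Section Matrices.
Variables (R : realDomainType) (n : nat).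
Notation Mat := 'M[tropical R]_n.
Implicit Types (i j : 'I_n) (a c : R).

Definition dilation (d : 'I_n -> R) : Mat :=
  diag_mx (\row_i (Some (d i) : tropical R)).

Definition dilation1 i a : Mat := dilation (fun j => if j == i then a else 0).

Definition transvection i j (x : tropical R) : Mat := 1 + x *: delta_mx i j.

Definition strict_upper (x : 'I_n -> 'I_n -> R) : Mat :=
  \matrix_(i, j) if (i < j)%N then Some (x i j) : tropical R else 0.

Lemma dilationE d i j :
  dilation d i j = if i == j then Some (d i) : tropical R else 0.
Proof. by rewrite !mxE; case: eqP. Qed.

Lemma dilationD d e : dilation d * dilation e = dilation (fun i => d i + e i).
Proof.
rewrite /dilation -mulmxE mulmx_diag.
by congr diag_mx; apply/rowP=> i; rewrite !mxE.
Qed.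

Lemma dilation_ext d e : d =1 e -> dilation d = dilation e.
Proof. by move=> de; apply/matrixP=> i j; rewrite !dilationE de. Qed.

Lemma dilation0 : dilation (fun=> 0) = 1.
Proof. by apply/matrixP=> i j; rewrite dilationE !mxE; case: eqP. Qed.

Lemma dilation1_0 i : dilation1 i 0 = 1.
Proof. by rewrite -dilation0; apply: dilation_ext => j; case: eqP. Qed.

Lemma dilation1D i : {morph dilation1 i : a c / a + c >-> a * c}.
Proof.
move=> a c; rewrite dilationD; apply: dilation_ext => j.
by case: eqP; rewrite ?addr0.
Qed.

Lemma dilation_prod d : dilation d = \prod_i dilation1 i (d i).
Proof.
have prodE (r : seq 'I_n) : \prod_(i <- r) dilation1 i (d i) =
    dilation (fun j => \sum_(i <- r) if j == i then d i else 0).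
  elim: r => [|i r IHr].
    by rewrite big_nil -dilation0; apply: dilation_ext => j; rewrite big_nil.
  rewrite big_cons IHr dilationD; apply: dilation_ext => j.
  by rewrite big_cons.
rewrite prodE; apply: dilation_ext => j.
by rewrite -big_mkcond (big_pred1 j) // => i; rewrite eq_sym.
Qed.

(** A finite value enters the off-diagonal position through the row scaling on
the left, while the scaling on the right acts on column i, where e_ij vanishes;
the two scalings cancel on the diagonal. *)
Lemma transvection_conj i j a : i != j ->
  dilation1 i a * transvection i j 1 * dilation1 i (- a) =
  transvection i j (Some a).
Proof.
move=> i_j; rewrite mulrDr mulrDl mulr1 -dilation1D subrr dilation1_0.
congr (1 + _); rewrite scale1r -mulmxE mul_diag_mx mul_mx_diag.
apply/matrixP=> k l; rewrite !mxE.
case: (eqVneq l j) => [->|_]; last by rewrite andbF !mulr0 mul0r.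
rewrite (eq_sym j i) (negPf i_j) andbT.
case: (eqVneq k i) => _ /=; last by rewrite !mulr0 mul0r.
by rewrite !mulr1.
Qed.

Lemma strict_upper_sum x :
  strict_upper x = \sum_(p : 'I_n * 'I_n | (p.1 < p.2)%N)
    (Some (x p.1 p.2) : tropical R) *: delta_mx p.1 p.2.
Proof.
rewrite [LHS]matrix_sum_delta pair_bigA [RHS]big_mkcond /=.
apply: eq_bigr => p _.
by rewrite mxE; case: ifP => // _; rewrite scale0r.
Qed.

(** The pairs are listed by decreasing first index. If (i, j) comes before
(k, l) then k <= i < j, hence e_ij e_kl = 0. *)
Lemma strict_upper_prod (x : 'I_n -> 'I_n -> R) : exists r : seq ('I_n * 'I_n),
  [/\ {in r, forall p : 'I_n * 'I_n, (p.1 < p.2)%N}, (size r <= n * n)%N &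
      1 + strict_upper x =
        \prod_(p <- r) transvection p.1 p.2 (Some (x p.1 p.2))].
Proof.
pose below (p q : 'I_n * 'I_n) := (q.1 <= p.1)%N.
pose pairs := [seq p : 'I_n * 'I_n <- index_enum _ | (p.1 < p.2)%N].
pose r := sort below pairs.
exists r; split.
- by move=> p; rewrite mem_sort mem_filter => /andP[].
- rewrite size_sort size_filter; apply: leq_trans (count_size _ _) _.
  have -> : size (index_enum ('I_n * 'I_n)%type) = #|{: 'I_n * 'I_n}|.
    by rewrite cardT /index_enum -enumT.
  by rewrite card_prod card_ord.
rewrite prod_1D; last first.
  have below_total : total below by move=> p q; exact: leq_total.
  have := sort_sorted below_total pairs.
  rewrite sorted_pairwise; last by move=> p q s pq /leq_trans; exact.
  pose increasing := [pred p : 'I_n * 'I_n | p.1 < p.2]%N.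
  apply: (sub_in_pairwise (P := increasing)) => [p q p_lt q_lt q_p|].
    rewrite -mulmxE -scalemxAl -scalemxAr mul_delta_mx_cond.
    suff /negPf -> : p.2 != q.1 by rewrite mulr0n !scaler0.
    by apply: contraTneq p_lt => p2; rewrite inE p2 -leqNgt.
  by apply/allP => p; rewrite mem_sort mem_filter => /andP[].
rewrite strict_upper_sum -big_filter; congr (1 + _).
by apply: perm_big; rewrite perm_sym perm_sort.
Qed.
End Matrices.

(** * The generators and the group of their entries *)

Section Generators.
Variables (R : realDomainType) (n t : nat) (b : 'I_t -> R).
Notation Mat := 'M[tropical R]_n.

Definition int_span : set R :=
  fun x => exists z : 'I_t -> int, x = \sum_s b s *~ z s.

(** The identity is included so that the empty word has the value of a word
with one letter; both signs are there because [transvection_conj] uses a scaling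
and its inverse. *)
Definition generators : seq Mat :=
  1 :: [seq dilation1 p.1 (if p.2.2 then b p.2.1 else - b p.2.1)
         | p : 'I_n * ('I_t * bool)]
    ++ [seq transvection p.1 p.2 1
         | p : 'I_n * 'I_n in [pred p : 'I_n * 'I_n | (p.1 < p.2)%N]].

Definition generator_fset : {fset Mat} := [fset A in generators]%fset.

Lemma generator1 : 1 \in generator_fset.
Proof. by rewrite in_fset in_cons eqxx. Qed.

Lemma generator_dilation i s (e : bool) :
  dilation1 i (if e then b s else - b s) \in generator_fset.
Proof.
rewrite in_fset in_cons mem_cat; apply/orP; right; apply/orP; left.
by apply/mapP; exists (i, (s, e)); rewrite ?mem_enum.
Qed.

Lemma generator_transvection (i j : 'I_n) :
  (i < j)%N -> transvection i j 1 \in generator_fset.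
Proof.
move=> ij; rewrite in_fset in_cons mem_cat; apply/orP; right; apply/orP; right.
by apply/mapP; exists (i, j); rewrite ?mem_enum.
Qed.

Lemma generator_ind (P : Mat -> Prop) :
  P 1 -> (forall i s (e : bool), P (dilation1 i (if e then b s else - b s))) ->
  (forall i j : 'I_n, (i < j)%N -> P (transvection i j 1)) ->
  forall A, A \in generator_fset -> P A.
Proof.
move=> P1 Pd Pt A; rewrite in_fset in_cons mem_cat.
case/or3P => [/eqP -> //|/mapP[p _ ->]|].
  exact: Pd.
by case/mapP => p; rewrite mem_enum => p_lt ->; exact: Pt.
Qed.

Lemma generators_UT : [set` generator_fset] `<=` @UT R n.
Proof.
apply: (@generator_ind (@UT R n)) => [i j ji|k s e i j ji|k l kl i j ji].
- by rewrite mxE; case: eqP ji => // ->; rewrite ltnn.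
- by rewrite dilationE; case: eqP ji => // ->; rewrite ltnn.
rewrite !mxE; case: eqP ji => [->|_ ji]; first by rewrite ltnn.
case: eqP => //= ik; case: eqP => //= jl; rewrite ?mulr0 ?add0r //.
by move: kl; rewrite -ik -jl ltnNge ltnW.
Qed.

Lemma int_span_zmod : GRing.zmod_closed (mem int_span).
Proof.
split=> [|x y]; first by rewrite inE; exists (fun=> 0); rewrite big1.
rewrite !inE => -[z ->] [w ->]; exists (fun s => z s - w s).
by rewrite -sumrB; apply: eq_bigr => s _; rewrite mulrzBr.
Qed.

Lemma int_span_basis s : int_span (b s).
Proof.
exists (fun r => (r == s)%:Z); rewrite (bigD1 s) //= eqxx big1 ?addr0 // => r.
by move=> /negPf ->.
Qed.

Lemma int_span_min (H : set R) :
  GRing.zmod_closed (mem H) -> (forall s, H (b s)) -> int_span `<=` H.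
Proof.
move=> [H0 HB] Hb _ [z ->].
have HN x : x \in H -> - x \in H by move=> Hx; rewrite -sub0r; exact: HB.
have HD x y : x \in H -> y \in H -> x + y \in H.
  by move=> Hx Hy; rewrite -[y]opprK; apply: HB => //; exact: HN.
have HM x k : x \in H -> x *+ k \in H.
  by move=> Hx; elim: k => [|k IHk]; rewrite ?mulr0n // mulrS; exact: HD.
rewrite -in_setE; apply: (big_ind (fun x => x \in H)) => // s _.
have bH : b s \in H by rewrite in_setE.
by case: (z s) => k; [exact: HM | apply: HN; exact: HM].
Qed.

(** A finite entry of a tropical product is a maximum of sums of entries, so it
is one of these sums. *)
Lemma entries_mul (H : set R) (A B : Mat) :
  (forall x y, H x -> H y -> H (x + y)) ->
  (forall i j x, A i j = Some x -> H x) ->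
  (forall i j x, B i j = Some x -> H x) ->
  forall i j x, (A *m B) i j = Some x -> H x.
Proof.
move=> HD HA HB i j; rewrite mxE.
apply: (big_ind (fun y : tropical R => forall x, y = Some x -> H x)) => //.
- move=> [y|] [w|] Hy Hw x //=; try by move/Hy + move/Hw.
  case=> <-; rewrite /Num.max; case: ifP => _; [exact: Hw | exact: Hy].
move=> k _ x; case Aik: (A i k) => [y|] //; case Bkj: (B k j) => [w|] // [<-].
by apply: HD; [apply: HA Aik | apply: HB Bkj].
Qed.

Lemma subgroup_gen_entries : (0 < n)%N ->
  subgroup_gen
      (finite_entries (subsemigroup_gen mulmx [set` generator_fset]))
    = int_span.
Proof.
move=> n_gt0; have [S0 SB] := int_span_zmod; move: S0; rewrite inE => S0.
have SN x : int_span x -> int_span (- x).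
  by move=> Sx; have := SB 0 x; rewrite !inE sub0r; exact.
have SD x y : int_span x -> int_span y -> int_span (x + y).
  by move=> Sx /SN Sy; have := SB x (- y); rewrite !inE opprK; exact.
have S1 y : (1 : tropical R) = Some y -> int_span y by move=> /Some_inj <-.
have S11 y : (1 + 1 : tropical R) = Some y -> int_span y.
  by move=> /Some_inj <-; rewrite maxxx.
apply/seteqP; split.
  apply: smallest_sub; first exact: int_span_zmod.
  move=> x [A [genA [i [j]]]].
  pose entries_in : set Mat :=
    fun A => forall i j x, A i j = Some x -> int_span x.
  suff : entries_in A by exact.
  apply: genA; split=> [B C HB HC|]; first exact: entries_mul.
  apply: (@generator_ind entries_in) => [k l y|k s e k' l y|k l _ k' l' y].
  - by rewrite mxE; case: eqP => // _; exact: S1.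
  - rewrite dilationE; case: eqP => // _ [<-]; case: eqP => // _.
    by case: e; [|apply: SN]; exact: int_span_basis.
  rewrite !mxE mul1r; case: (k' == l'); case: (_ && _) => //=.
  - exact: S11.
  - by rewrite addr0; exact: S1.
  by rewrite add0r; exact: S1.
move=> x Sx H [H_zmod entH]; apply: int_span_min Sx => // s.
apply: entH; pose i := Ordinal n_gt0; exists (dilation1 i (b s)).
split; last by exists i, i; rewrite dilationE !eqxx.
by move=> G [_ XG]; apply: XG; apply: generator_dilation s true.
Qed.
End Generators.

(** * Many distinct short words *)

Section Counting.
Variables (R : realDomainType) (n t : nat) (b : 'I_t -> R).
Hypothesis b_free :
  forall z : 'I_t -> int, \sum_s b s *~ z s = 0 -> forall s, z s = 0.
Notation Mat := 'M[tropical R]_n.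
Let X : {fset Mat} := generator_fset n b.

Lemma combination_inj (y z : 'I_t -> nat) :
  \sum_s b s *+ y s = \sum_s b s *+ z s -> y =1 z.
Proof.
move=> /eqP; rewrite -subr_eq0 -sumrB => /eqP yz s.
have /b_free/(_ s)/eqP : \sum_s b s *~ ((y s)%:Z - (z s)%:Z) = 0.
  by rewrite -[RHS]yz; apply: eq_bigr => r _; rewrite mulrzBr.
by rewrite subr_eq0 => /eqP[].
Qed.

Lemma dilation1_combination_word i (e : bool) (z : 'I_t -> nat) m :
  (forall s, (z s <= m)%N) ->
  word_of_length_le X (t * m)
    (dilation1 i (if e then \sum_s b s *+ z s else - \sum_s b s *+ z s)).
Proof.
move=> z_m; pose c s := if e then b s else - b s.
have -> : (if e then \sum_s b s *+ z s else - \sum_s b s *+ z s) =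
    \sum_s c s *+ z s.
  rewrite /c; case: (e); rewrite // -sumrN.
  by apply: eq_bigr => s _; rewrite mulNrn.
rewrite (big_morph _ (@dilation1D R n i) (dilation1_0 _ i)).
apply: word_prod_ord => s; apply: word_le (z_m s) _.
have -> : dilation1 i (c s *+ z s) = dilation1 i (c s) ^+ z s.
  elim: (z s) => [|k IHk]; first by rewrite dilation1_0.
  by rewrite mulrS exprS dilation1D IHk.
by apply: word_expr; exact: generator_dilation.
Qed.

Lemma transvection_combination_word (i j : 'I_n) (z : 'I_t -> nat) m :
  (i < j)%N -> (forall s, (z s <= m)%N) ->
  word_of_length_le X (t * m + 1 + t * m)
    (transvection i j (Some (\sum_s b s *+ z s))).
Proof.
move=> ij z_m; rewrite -transvection_conj ?neq_ltn ?ij //.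
apply: word_mul (dilation1_combination_word i false z_m).
apply: word_mul (dilation1_combination_word i true z_m) _.
exact/word_gen/generator_transvection.
Qed.

Section Bounded.
Variable m : nat.
Implicit Type z : {ffun 'I_n * 'I_n * 'I_t -> 'I_m.+1}.

Definition combination z (i j : 'I_n) : R := \sum_s b s *+ z (i, j, s).

(** The parameter [z (i, j, s)] is the coordinate along [b s] of the number
attached to the position (i, j). The diagonal factor multiplies row i, so the
entry at (i, j) with i < j is the sum of the numbers attached to (i, i) and
(i, j), see [encodeE]. *)
Definition encode z : Mat :=
  dilation (fun i => combination z i i) * (1 + strict_upper (combination z)).

Definition upper : {pred 'I_n * 'I_n * 'I_t} :=
  [pred p : 'I_n * 'I_n * 'I_t | p.1.1 <= p.1.2]%N.

Lemma encodeE z i j :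
  encode z i j =
  if i == j then Some (combination z i i) : tropical R
  else if (i < j)%N then
    Some (combination z i i + combination z i j) : tropical R
  else 0.
Proof.
rewrite /encode -mulmxE mul_diag_mx !mxE.
case: eqP => [->|_]; first by rewrite ltnn addr0 mulr1.
by case: ifP => _; rewrite add0r ?mulr0.
Qed.

(** The diagonal of the matrix gives back the diagonal parameters, and then the
other entries give back the rest. The support condition fixes the parameters
below the diagonal, which the matrix does not see. *)
Lemma encode_inj : {in pffun_on ord0 upper predT &, injective encode}.
Proof.
move=> y z /pffun_onP[y_supp _] /pffun_onP[z_supp _] /matrixP yz.
have diag i : combination y i i = combination z i i.
  by have := yz i i; rewrite !encodeE eqxx => -[].
apply/ffunP => -[[i j] s]; apply/val_inj => /=.
case: (ltngtP i j) => [ij|ji|/val_inj ij]; last 1 first.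
- subst j; exact: (combination_inj (diag i) s).
- have := yz i j; rewrite !encodeE ij; case: eqP => [/(congr1 val) /= ij'|_].
    by rewrite ij' ltnn in ij.
  by case; rewrite diag => /addrI /combination_inj /(_ s).
have out (w : {ffun 'I_n * 'I_n * 'I_t -> 'I_m.+1}) :
    ord0.-support w \subset upper -> w (i, j, s) = ord0.
  move=> /fintype.subsetP /(_ (i, j, s)) sub; apply/eqP/negPn/negP => w0.
  by have := sub w0; rewrite inE /= leqNgt ji.
by rewrite !out.
Qed.

(** One diagonal matrix costs n t m letters, and each of the at most n^2
transvections costs 2 t m + 1, which is at most (2 t + 1) m when m > 0. The
successor makes the constant positive for all n and t. *)
Definition word_constant : nat := (n * t + (n * n) * (t + 1 + t)).+1.

Lemma encode_word z :
  (0 < m)%N -> word_of_length_le X (word_constant * m) (encode z).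
Proof.
move=> m_gt0; have z_m i j s : (z (i, j, s) <= m)%N by rewrite -ltnS.
have [r [r_lt r_size prod_r]] := strict_upper_prod (combination z).
apply: (@word_le _ _ (n * (t * m) + size r * (t * m + 1 + t * m))); last first.
  apply: word_mul.
    rewrite dilation_prod.
    by apply: word_prod_ord => i; apply: (dilation1_combination_word i true).
  rewrite prod_r; apply: word_prod => p /r_lt p_lt.
  exact: transvection_combination_word.
rewrite /word_constant mulSn mulnDl mulnA.
apply: leq_trans (leq_addl _ _); rewrite leq_add2l -mulnA leq_mul //.
by rewrite !mulnDl mul1n leq_add2r leq_add2l.
Qed.
End Bounded.

Lemma card_upper : #|upper| = ((t * n * (n + 1)) %/ 2)%N.
Proof.
have -> : #|upper| = (\sum_(j < n) t * j.+1)%N.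
  rewrite -sum1_card big_mkcond /=.
  rewrite -(pair_bigA _ (fun p s => if (p, s) \in upper then 1 else 0))%N /=.
  rewrite (eq_bigr (fun p : 'I_n * 'I_n =>
    if (p.1 <= p.2)%N then t else 0)%N); last first.
    move=> p _.
    transitivity (\sum_(s < t) if (p.1 <= p.2)%N then 1 else 0)%N; first by [].
    by case: (p.1 <= p.2)%N; rewrite sum_nat_const card_ord ?muln1 ?muln0.
  rewrite -(pair_bigA _ (fun i j : 'I_n => if (i <= j)%N then t else 0))%N /=.
  rewrite exchange_big; apply: eq_bigr => j _ /=.
  rewrite -big_mkcond; rewrite (big_ord_narrow (ltn_ord j)) /=.
  by rewrite sum_nat_const card_ord mulnC.
rewrite -big_distrr /= -mulnA -muln_divA; last first.
  by rewrite addn1 dvdn2 oddM /= andbN.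
congr (_ * _)%N.
rewrite addn1 mulnC divn2 -[(_ * n)%N]/(n.+1 * n.+1.-1)%N -bin2.
by rewrite -triangular_sum big_mkord big_ord_recl add0n.
Qed.

Lemma growth_lower_bound (m k : nat) :
  (0 < m)%N -> (word_constant * m <= k)%N ->
  (m.+1 ^ ((t * n * (n + 1)) %/ 2) <= growth *%R X k)%N.
Proof.
move=> m_gt0 m_k; rewrite -card_upper -{1}[m.+1]card_ord.
rewrite -(card_pffun_on (ord0 : 'I_m.+1) upper predT).
apply: growth_ge (generator1 n b) _ (@encode_inj m) _.
  by apply: leq_trans m_k; rewrite muln_gt0.
by move=> z _; apply: word_le m_k _; exact: encode_word.
Qed.

End Counting.

(** Apply the bound with m = floor (k / C), for which k < C (m + 1). When k < C
the bound says nothing, but then c k^M <= 1 for c = C^-M, and positivity of f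
suffices. *)
Lemma poly_bounded_below_of_floor (R : realFieldType) (f : nat -> nat)
    (C M : nat) :
  (0 < C)%N -> (forall k, 0 < k -> 0 < f k)%N ->
  (forall m k, 0 < m -> C * m <= k -> m.+1 ^ M <= f k)%N ->
  exists c : R, 0 < c /\ poly_bounded_below f c M.
Proof.
move=> C_gt0 f_gt0 f_ge; exists ((C ^ M)%:R^-1).
have CM_gt0 : 0 < ((C ^ M)%:R : R) by rewrite ltr0n expn_gt0 C_gt0.
split=> [|k k_gt0]; first by rewrite invr_gt0.
rewrite mulrC ler_pdivrMr // -natrX -natrM ler_nat.
suff : (((k %/ C).+1) ^ M <= f k)%N.
  move=> fk; apply: (@leq_trans ((k %/ C).+1 ^ M * C ^ M)); last first.
    by rewrite leq_mul2r fk orbT.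
  rewrite -expnMn; case: (M) => // M'.
  by rewrite leq_exp2r // ltnW // ltn_ceil.
case: (posnP (k %/ C)) => [->|m_gt0]; first by rewrite exp1n f_gt0.
by apply: f_ge; rewrite // mulnC leq_divM.
Qed.

(* n (n + 1) is even, so the division by 2 in the exponent is exact. *)
Theorem theorem6p8 (R : realType) (n t : nat) (hn : (0 < n)%N) :
  exists X : {fset 'M[tropical R]_n},
    [/\ [set` X] `<=` @UT R n,
        free_abelian_of_rank
          (subgroup_gen (finite_entries (subsemigroup_gen mulmx [set` X]))) t
      & exists c : R, 0 < c /\
          poly_bounded_below (growth mulmx X) c ((t * n * (n + 1)) %/ 2)%N].
Proof.
have [p [p_prime p_mono]] := increasing_primes_exist.
have p_inj : injective (fun s : 'I_t => p s).
  move=> r s pr; apply/val_inj => /=; case: (ltngtP r s) => // /p_mono.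
    by rewrite pr ltnn.
  by rewrite pr ltnn.
pose b (s : 'I_t) : R := ln (p s)%:R.
have b_free :
    forall z : 'I_t -> int, \sum_s b s *~ z s = 0 -> forall s, z s = 0.
  exact: ln_primes_free.
exists (generator_fset n b); split; first exact: generators_UT.
  exists b; split=> // x; rewrite subgroup_gen_entries //.
apply: (@poly_bounded_below_of_floor R _ (word_constant n t)) => //.
  move=> k k_gt0; exact: growth_gt0 (generator1 n b) k_gt0.
move=> m k; exact: growth_lower_bound.
Qed.
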